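(* Let $\mathcal{X}\subset\mathbb{Z}$ be a finite alphabet, let $\bm{X}=(X_1,\dots,X_N)^T$ be a random vector with joint probability mass function $f:\mathcal{X}^N\to[0,1]$, let $\mathbb{F}_q$ be a finite field with $|\mathcal{X}|\le q$, and let $\mathcal{F}:\mathcal{X}\to\hat{\mathcal{X}}\subseteq\mathbb{F}_q$ be a bijection onto its image $\hat{\mathcal{X}}$. Let $\bm{A}$ be an $L\times N$ coding matrix with i.i.d. entries uniformly distributed over $\mathbb{F}_q$ and statistically independent of $\bm{X}$. Let $P_e$ be the probability of error of the maximum a posteriori (MAP) decoder that recovers $\hat{\bm{x}}=\mathcal{F}[\bm{x}]$ from $\bm{A}$ and the $L$ network coded symbols $\hat{\bm{y}}=\bm{A}\hat{\bm{x}}$. Then for every $\delta\in(0,1)$ and every $\rho\in(0,1]$, if the number $L$ of network coded symbols satisfies $$\frac{L}{N}\ge-\frac{\log_2\delta}{\rho N\log_2 q}+\frac{H_\rho(\bm{X})}{N\log_2 q}-\frac{D_{KL}(f_\rho(\bm{x})\,\|\,f(\bm{x}))}{\rho N\log_2 q},$$ then $P_e\le\delta$.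
   Context: Source vector: a realization $\bm{x}\in\mathcal{X}^N$ of $\bm{X}$ is mapped componentwise to $\hat{\bm{x}}=\mathcal{F}[\bm{x}]\in\hat{\mathcal{X}}^N\subseteq\mathbb{F}_q^N$. The joint pmf of the mapped vector is $\hat f(\hat{\bm{x}})=f(\mathcal{F}^{-1}[\hat{\bm{x}}])$ for $\hat{\bm{x}}\in\hat{\mathcal{X}}^N$ and $\hat f(\hat{\bm{x}})=0$ for $\hat{\bm{x}}\in\mathbb{F}_q^N\setminus\hat{\mathcal{X}}^N$. Observation: the decoder knows $\bm{A}\in\mathbb{F}_q^{L\times N}$ and $\hat{\bm{y}}=\bm{A}\hat{\bm{x}}\in\mathbb{F}_q^L$ (arithmetic in $\mathbb{F}_q$). MAP decoding rule: the decoder outputs $$\hat{\bm{x}}^*=\arg\max_{\hat{\bm{x}}\in\hat{\mathcal{X}}^N}\mathbb{1}_{\{\bm{A},\hat{\bm{y}}\}}(\hat{\bm{x}})\,\hat f(\hat{\bm{x}}),$$ where $\mathbb{1}_{\{\bm{A},\hat{\bm{y}}\}}(\hat{\bm{x}})=1$ if $\bm{A}\hat{\bm{x}}=\hat{\bm{y}}$ and $0$ otherwise. The error event is that the output $\hat{\bm{x}}^*$ differs from the transmitted $\hat{\bm{x}}$ (when there are several maximizers, i.e. another $\hat{\bm{w}}\neq\hat{\bm{x}}$ with $\bm{A}\hat{\bm{w}}=\hat{\bm{y}}$ and $\hat f(\hat{\bm{w}})\ge\hat f(\hat{\bm{x}})$, this is counted as an error). $P_e$ is the probability of the error event over the joint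 randomness of $\bm{X}$ and $\bm{A}$. Tilted distribution: $f_\rho(\bm{x})=f(\bm{x})^{\frac{1}{1+\rho}}\big/\sum_{\bm{x}'\in\mathcal{X}^N}f(\bm{x}')^{\frac{1}{1+\rho}}$ for $\bm{x}\in\mathcal{X}^N$; its entropy is $H_\rho(\bm{X})=-\sum_{\bm{x}\in\mathcal{X}^N}f_\rho(\bm{x})\log_2 f_\rho(\bm{x})$; and $D_{KL}(f_\rho\|f)=\sum_{\bm{x}\in\mathcal{X}^N}f_\rho(\bm{x})\log_2\frac{f_\rho(\bm{x})}{f(\bm{x})}$ is the Kullback-Leibler divergence, with the convention $0\log_2 0=0$ (terms with $f_\rho(\bm{x})=0$ are $0$). *)

(* Defs.v *)
From mathcomp Require Import all_boot all_order all_algebra finmap.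
From mathcomp Require Import all_classical all_reals all_analysis.

Set Implicit Arguments.
Unset Strict Implicit.
Unset Printing Implicit Defensive.

Import Order.TTheory GRing.Theory Num.Theory.

Local Open Scope classical_set_scope.
Local Open Scope ring_scope.

Section DiscreteRandomElements.
Context (d : measure_display) (T : measurableType d) (R : realType).
Implicit Type P : probability T R.

(* Measurability with respect to the discrete sigma-algebra on [V]. *)
Definition discrete_rv (V : Type) (Y : T -> V) : Prop :=
  forall B : set V, measurable (Y @^-1` B).

Definition has_pmf P (V : Type) (Y : T -> V) (f : V -> R) : Prop :=
  forall v, P (Y @^-1` [set v]) = (f v)%:E.

Definition uniformly_distributed P (V : finType) (Y : T -> V) : Prop :=
  has_pmf P Y (fun=> (#|V|%:R)^-1).

Definition mutually_independent P (I : finType) (V : Type)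
    (Y : I -> T -> V) : Prop :=
  forall (J : {set I}) (B : I -> set V),
    P (\bigcap_(i in [set` J]) (Y i @^-1` B i)) =
    (\prod_(i in J) P (Y i @^-1` B i))%E.

Definition independent P (V W : Type) (Y : T -> V) (Z : T -> W) : Prop :=
  forall (B : set V) (C : set W),
    P (Y @^-1` B `&` Z @^-1` C) = (P (Y @^-1` B) * P (Z @^-1` C))%E.

End DiscreteRandomElements.

Section InformationMeasures.
Context (R : realType) (V : finType).
Implicit Types f g : V -> R.

Definition log2 (x : R) : R := ln x / ln 2.

(* Since 0 `^ a = 0 for a != 0, points of zero mass keep zero mass. *)
Definition tilted (rho : R) f : V -> R := fun x =>
  f x `^ (1 / (1 + rho)) / \sum_(x' : V) f x' `^ (1 / (1 + rho)).

(* ln is total, so a term with zero leading factor is 0, as 0 log 0 = 0. *)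
Definition entropy f : R := - \sum_(x : V) f x * log2 (f x).

Definition KL f g : R := \sum_(x : V) f x * log2 (f x / g x).

End InformationMeasures.

Section MAPDecoding.
Context (R : realType) (K : finType) (F : finFieldType) (N L : nat).
Variables (phi : K -> F) (f : 'cV[K]_N -> R).

Definition Xhat : {set F} := [set phi a | a : K]%SET.

Definition XhatN : {set 'cV[F]_N} :=
  [set w : 'cV[F]_N | [forall i, w i 0 \in Xhat]]%SET.

(* For injective [phi], the pick succeeds exactly on [XhatN] and returns the
   componentwise inverse image of [w]. *)
Definition fhat (w : 'cV[F]_N) : R :=
  if [pick x : 'cV[K]_N | map_mx phi x == w] is Some x then f x else 0.

Definition MAP_objective (A : 'M[F]_(L, N)) (y : 'cV[F]_L)
    (w : 'cV[F]_N) : R :=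
  (A *m w == y)%:R * fhat w.

(* [dec A y] is one of the maximizers; how ties are broken is left open. *)
Definition is_MAP_decoder
    (dec : 'M[F]_(L, N) -> 'cV[F]_L -> 'cV[F]_N) : Prop :=
  forall A y, dec A y \in XhatN /\
    forall w, w \in XhatN -> MAP_objective A y w <= MAP_objective A y (dec A y).

(* Decoding error for the transmitted [x]: the output differs from [x], or the
   decoder faces a competitor at least as likely as [x], which is counted as an
   error whatever the output is. *)
Definition decoding_error (dec : 'M[F]_(L, N) -> 'cV[F]_L -> 'cV[F]_N)
    (A : 'M[F]_(L, N)) (x : 'cV[F]_N) : Prop :=
  let y := A *m x in
  dec A y <> x \/
  exists w, [/\ w \in XhatN, w <> x, A *m w = y & fhat x <= fhat w].

End MAPDecoding.

Definition error_probability (d : measure_display) (T : measurableType d)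
    (R : realType) (P : probability T R) (K : finType) (F : finFieldType)
    (N L : nat) (phi : K -> F) (f : 'cV[K]_N -> R)
    (dec : 'M[F]_(L, N) -> 'cV[F]_L -> 'cV[F]_N)
    (X : T -> 'cV[K]_N) (A : T -> 'M[F]_(L, N)) : \bar R :=
  P [set t | decoding_error phi f dec (A t) (map_mx phi (X t))].

(* Main.v *)
(* Gallager's random-coding argument. Conditionally on the source vector x, an
   error forces a competitor x' <> x with f x' >= f x and A (x' - x) = 0, an
   event of probability q^-L. With s = 1 / (1 + rho), the union bound,
   1_{f x' >= f x} <= (f x' / f x)^s and min(1, u) <= u^rho give
   P_e <= S^(1 + rho) q^(-L rho) for S = \sum_x f(x)^s. The condition on L says
   exactly that the right-hand side is at most delta, because
   H_rho - D_KL / rho = ((1 + rho) / rho) log2 S. *)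
Require Import Defs.
From mathcomp Require Import all_boot all_order all_algebra finmap.
From mathcomp Require Import all_classical all_reals all_analysis.
From mathcomp Require Import ring lra.

Set Implicit Arguments.
Unset Strict Implicit.
Unset Printing Implicit Defensive.

Import Order.TTheory GRing.Theory Num.Theory.

Local Open Scope classical_set_scope.
Local Open Scope ring_scope.

(** * Powers, base-2 logarithms and the entropy identity *)

Lemma min1_le_powR (R : realType) (p u r : R) :
  0 <= p <= 1 -> p <= u -> 0 <= r <= 1 -> p <= u `^ r.
Proof.
move=> /andP[p0 p1] pu /andP[r0 r1].
have [->|pN0] := eqVneq p 0; first exact: powR_ge0.
have pp : 0 < p by rewrite lt_neqAle eq_sym pN0.
(* Raising a number of (0, 1] to an exponent at most 1 does not decrease it; monotonicity of the
   power then replaces [p] by [u]. *)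
apply: (@le_trans _ _ (p `^ r)); first by apply: ger1_powR => //; rewrite pp.
by apply: ge0_ler_powR => //; rewrite nnegrE // (le_trans p0).
Qed.

Lemma log2_div (R : realType) (x y : R) :
  0 < x -> 0 < y -> log2 (x / y) = log2 x - log2 y.
Proof. by move=> x0 y0; rewrite /log2 ln_div ?posrE// mulrBl. Qed.

Lemma log2_powR (R : realType) (a x : R) : log2 (a `^ x) = x * log2 a.
Proof. by rewrite /log2 ln_powR mulrA. Qed.

Lemma log2_gt0 (R : realType) (x : R) : 1 < x -> 0 < log2 x.
Proof. by move=> x1; rewrite divr_gt0// ln_gt0// ltr1n. Qed.

Lemma ler_log2 (R : realType) : {in Num.pos &, {mono @log2 R : x y / x <= y}}.
Proof.
move=> x y x0 y0; rewrite /log2 ler_pM2r ?ler_ln//.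
by rewrite invr_gt0 ln_gt0// ltr1n.
Qed.

Lemma log2M (R : realType) (x y : R) :
  0 < x -> 0 < y -> log2 (x * y) = log2 x + log2 y.
Proof. by move=> x0 y0; rewrite /log2 lnM ?posrE// mulrDl. Qed.

(** With s = 1 / (1 + rho) and S the normalising sum, log2 of the tilted mass is s log2 f - log2 S.
    In the combination of entropy and divergence it has coefficient -(1 + rho) / rho, so the log2 f
    terms cancel and only the constant log2 S survives. *)
Lemma entropy_tilted_KL (R : realType) (V : finType) (f : V -> R) (rho : R) :
  (forall x, 0 <= f x) -> 0 < \sum_x f x `^ (1 / (1 + rho)) -> 0 < rho ->
  entropy (tilted rho f) - KL (tilted rho f) f / rho =
  (1 + rho) / rho * log2 (\sum_x f x `^ (1 / (1 + rho))).
Proof.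
move=> f0 S0 rho0; set S := \sum_x _ in S0 *.
have rho1 : 1 + rho != 0 by apply: lt0r_neq0; lra.
have rhoN0 : rho != 0 by lra.
have sum1 : \sum_x tilted rho f x = 1 by rewrite -mulr_suml divff// lt0r_neq0.
(* The constant right-hand side is written as its own average under [tilted rho f], which reduces
   the claim to an identity at each point. *)
rewrite -[RHS]mul1r -{1}sum1 mulr_suml /entropy /KL mulr_suml -opprD -big_split/=.
rewrite -sumrN; apply: eq_bigr => x _.
have [fx0|fxN0] := eqVneq (f x) 0.
  rewrite /tilted fx0 powR0; first by rewrite !mul0r addr0 oppr0.
  by rewrite mul1r invr_neq0.
have fx_gt0 : 0 < f x by rewrite lt_neqAle eq_sym fxN0 f0.
have tx_gt0 : 0 < tilted rho f x by rewrite divr_gt0// powR_gt0.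
rewrite (log2_div tx_gt0)// {2 4}/tilted log2_div ?powR_gt0// log2_powR -/S.
by field; rewrite rhoN0.
Qed.

(** * Union bounds over finite index types *)

Section FiniteUnionBound.
Context (d : measure_display) (T : measurableType d) (R : realType).
Context (P : probability T R).

(** The cover is given pointwise so that the same bound serves for the values of a random element,
    for the competitors and for the source vectors. *)
Lemma measure_fin_union_bound (I : finType) (Q : pred I) (E : I -> set T)
    (B : set T) :
  measurable B -> (forall i, measurable (E i)) ->
  (forall t, B t -> exists2 i, Q i & E i t) ->
  (P B <= \sum_(i | Q i) P (E i))%E.
Proof.
move=> mB mE BE.
have mU (r : seq I) : measurable (\big[setU/set0]_(i <- r | Q i) E i).
  exact: bigsetU_measurable.
apply: (@le_trans _ _ (P (\big[setU/set0]_(i | Q i) E i))).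
  apply: le_measure; rewrite ?inE//.
  by move=> t /BE[i Qi Eit]; rewrite (bigD1 i)//=; left.
rewrite -!(big_filter _ Q); elim: [seq _ <- _ | _] => [|i r IH].
  by rewrite !big_nil measure0.
rewrite !big_cons; apply: (le_trans (measureU2 _ _ _)) => //.
  exact: bigsetU_measurable.
exact: leeD.
Qed.

Lemma discrete_rv_prob_le (V : finType) (Y : T -> V) (B : {set V}) :
  discrete_rv Y ->
  (P (Y @^-1` [set` B]) <= \sum_(v in B) P (Y @^-1` [set v]))%E.
Proof.
move=> Yrv; apply: measure_fin_union_bound => // t /= Bt.
by exists (Y t).
Qed.

Lemma pmf_ge0 (V : Type) (Y : T -> V) (f : V -> R) :
  has_pmf P Y f -> forall v, 0 <= f v.
Proof. by move=> Yf v; rewrite -lee_fin -Yf measure_ge0. Qed.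

(** This excludes an identically zero [f], and thereby makes the normalising sum of [tilted rho f]
    positive. *)
Lemma pmf_sum_ge1 (V : finType) (Y : T -> V) (f : V -> R) :
  discrete_rv Y -> has_pmf P Y f -> 1 <= \sum_v f v.
Proof.
move=> Yrv Yf; rewrite -lee_fin -(probability_setT P) -sumEFin.
under eq_bigr => v _ do rewrite -Yf.
by apply: measure_fin_union_bound => // t _; exists (Y t).
Qed.

End FiniteUnionBound.

(* The fibres of [M |-> M *m v] are translates of each other, since
   [y *m u *m v = y] for a row vector [u] with [u *m v = 1]. *)
Lemma card_mulmx_col_eq0 (F : finFieldType) (L N : nat) (v : 'cV[F]_N) :
  v != 0 ->
  (#|[set M : 'M[F]_(L, N) | M *m v == 0%R]%SET| * #|F| ^ L = #|F| ^ (L * N))%N.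
Proof.
move=> vN0.
have [j vj] : exists j, v j 0 != 0.
  apply/existsP; apply: contraNT vN0 => /existsPn v0; apply/eqP/colP => i.
  by rewrite mxE; apply/eqP; rewrite -[_ == _]negbK v0.
pose u : 'rV[F]_N := (v j 0)^-1 *: delta_mx 0 j.
have uv : u *m v = 1%:M.
  rewrite -scalemxAl -rowE; apply/matrixP => i k.
  by rewrite !ord1 !mxE eqxx mulVf.
have fibre (y : 'cV[F]_L) :
    (\sum_(M : 'M[F]_(L, N) | M *m v == y) 1)%N =
    #|[set M : 'M[F]_(L, N) | M *m v == 0]%SET|.
  rewrite sum1dep_card -[RHS](card_imset _ (@addrI _ (y *m u))).
  apply: eq_card => M; rewrite [LHS]inE; apply/eqP/imsetP => [Mv|[M' + ->]].
    exists (M - y *m u); last by rewrite addrC subrK.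
    by rewrite inE mulmxBl Mv -mulmxA uv mulmx1 subrr.
  by rewrite inE => /eqP M'v; rewrite mulmxDl M'v -mulmxA uv mulmx1 addr0.
rewrite -[RHS]card_mx -[RHS]sum1_card.
rewrite (partition_big (fun M : 'M[F]_(L, N) => M *m v) predT)//=.
rewrite [RHS](eq_bigr (fun=> #|[set M : 'M[F]_(L, N) | M *m v == 0%R]%SET|)).
  by rewrite sum_nat_const card_mx muln1 mulnC.
by move=> y _; exact: fibre.
Qed.

(** * The uniform random matrix and its kernel *)

Section RandomMatrix.
Context (d : measure_display) (T : measurableType d) (R : realType).
Context (P : probability T R) (F : finFieldType) (L N : nat).
Variable A : T -> 'M[F]_(L, N).
Hypothesis A_rv : discrete_rv A.
Hypothesis A_unif : forall i j, uniformly_distributed P (fun t => A t i j).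
Hypothesis A_indep : mutually_independent P
  (fun (ij : 'I_L * 'I_N) t => A t ij.1 ij.2).

Lemma iid_matrix_pmf (M : 'M[F]_(L, N)) :
  P (A @^-1` [set M]) = ((#|F|%:R ^- (L * N))%:E).
Proof.
(* Fixing the matrix is fixing every entry, so mutual independence applies with the full index
   set. *)
have -> : A @^-1` [set M] = \bigcap_(ij in [set` [set: 'I_L * 'I_N]%SET])
    ((fun t => A t ij.1 ij.2) @^-1` [set M ij.1 ij.2]).
  apply/seteqP; split => t /=; first by move=> AtM ij _ /=; rewrite AtM.
  by move=> At; apply/matrixP => i j; apply: (At (i, j)); rewrite /= inE.
rewrite (A_indep [set: _]%SET (fun ij => [set M ij.1 ij.2])).
under eq_bigr => ij _ do rewrite (A_unif ij.1 ij.2 (M ij.1 ij.2)).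
rewrite prodEFin prodr_const; congr (_%:E).
by rewrite cardsT card_prod !card_ord exprVn.
Qed.

(** With q = [#|F|], the matrices killing [v] number q^(LN) / q^L, and each has probability
    q^(-LN). *)
Lemma iid_matrix_kernel_prob (v : 'cV[F]_N) : v != 0 ->
  (P (A @^-1` [set M | (M *m v = 0)%R]) <= (#|F|%:R ^- L)%:E)%E.
Proof.
move=> /(card_mulmx_col_eq0 L) cardK.
have -> : [set M : 'M[F]_(L, N) | M *m v = 0] =
    [set` [set M : 'M[F]_(L, N) | M *m v == 0]%SET].
  by apply/seteqP; split => M /=; rewrite inE => /eqP.
apply: (le_trans (discrete_rv_prob_le _ _ A_rv)).
under eq_bigr => M _ do rewrite iid_matrix_pmf.
rewrite sumEFin lee_fin sumr_const.
have q0 n : (#|F|%:R ^+ n : R) != 0.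
  by rewrite expf_neq0// pnatr_eq0 -lt0n (cardD1 0).
rewrite -(@ler_pM2r _ (#|F|%:R ^+ L)) ?mulVf//; last first.
  by rewrite lt_neqAle eq_sym q0 exprn_ge0.
by rewrite -[X in X * _]mulr_natl mulrAC -natrX -natrM cardK natrX mulfV.
Qed.

End RandomMatrix.

Lemma inj_map_mx (aT rT : Type) (g : aT -> rT) (m n : nat) :
  injective g -> injective (@map_mx aT rT g m n).
Proof.
move=> g_inj M1 M2 /matrixP eM; apply/matrixP => i j; apply: g_inj.
by have := eM i j; rewrite !mxE.
Qed.

(** * Deterministic analysis of a decoding error *)

Section Decoder.
Context (R : realType) (K : finType) (F : finFieldType) (N L : nat).
Variables (phi : K -> F) (f : 'cV[K]_N -> R).
Hypothesis phi_inj : injective phi.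

Lemma fhat_map_mx (x : 'cV[K]_N) : fhat phi f (map_mx phi x) = f x.
Proof.
rewrite /fhat; case: pickP => [x' /eqP/(inj_map_mx phi_inj)->//|/(_ x)].
by rewrite eqxx.
Qed.

Lemma XhatNP (w : 'cV[F]_N) :
  reflect (exists x : 'cV[K]_N, w = map_mx phi x) (w \in XhatN N phi).
Proof.
rewrite inE; apply: (iffP forallP) => [wX|[x ->] i]; last first.
  by rewrite mxE imset_f.
have /fin_all_exists[g gE] i : exists a, w i 0 = phi a.
  by have /imsetP[a _ ->] := wX i; exists a.
by exists (\col_i g i); apply/colP => i; rewrite !mxE gE.
Qed.

(** A tie or a better candidate is a competitor by definition. A wrong output is one too: it
    maximizes an objective whose value at the transmitted vector is [f x]. *)
Lemma decoding_error_competitor dec (A : 'M[F]_(L, N)) (x : 'cV[K]_N) :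
  is_MAP_decoder phi f dec -> 0 < f x ->
  decoding_error phi f dec A (map_mx phi x) ->
  exists2 x', (x' != x) && (f x <= f x') &
    A *m (map_mx phi x' - map_mx phi x) = 0.
Proof.
move=> decM fx0 err.
suff [w [/XhatNP[x' ->] wx Aw fw]] : exists w, [/\ w \in XhatN N phi,
    w <> map_mx phi x, A *m w = A *m map_mx phi x
    & fhat phi f (map_mx phi x) <= fhat phi f w].
  exists x'; last by rewrite mulmxBr Aw subrr.
  rewrite !fhat_map_mx in fw; rewrite fw andbT.
  by apply/eqP => xx'; apply: wx; rewrite xx'.
case: err => [decx|//]; exists (dec A (A *m map_mx phi x)).
have [decX /(_ (map_mx phi x))] := decM A (A *m map_mx phi x).
rewrite /MAP_objective eqxx mul1r fhat_map_mx => le_obj.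
have {le_obj} := le_obj (introT (XhatNP _) (ex_intro _ x erefl)).
case: eqP => [Aw|_]; first by rewrite mul1r; split.
(* An output violating the linear constraint has objective 0, which cannot reach [f x > 0]. *)
by rewrite mul0r leNgt fx0.
Qed.

End Decoder.

(** * Random-coding bound on the error probability *)

Section MAPErrorBound.
Context (d : measure_display) (T : measurableType d) (R : realType).
Context (P : probability T R) (K : finType) (F : finFieldType) (N L : nat).
Variables (phi : K -> F) (X : T -> 'cV[K]_N) (f : 'cV[K]_N -> R).
Variables (A : T -> 'M[F]_(L, N)).
Variable dec : 'M[F]_(L, N) -> 'cV[F]_L -> 'cV[F]_N.
Hypothesis phi_inj : injective phi.
Hypothesis X_rv : discrete_rv X.
Hypothesis X_pmf : has_pmf P X f.
Hypothesis A_rv : discrete_rv A.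
Hypothesis A_unif : forall i j, uniformly_distributed P (fun t => A t i j).
Hypothesis A_indep : mutually_independent P
  (fun (ij : 'I_L * 'I_N) t => A t ij.1 ij.2).
Hypothesis AX_indep : independent P A X.
Hypothesis dec_MAP : is_MAP_decoder phi f dec.

Let q : R := #|F|%:R.

Let err (x : 'cV[K]_N) : set 'M[F]_(L, N) :=
  [set M | decoding_error phi f dec M (map_mx phi x)].

Let f_ge0 : forall x, 0 <= f x := pmf_ge0 X_pmf.

(** Injectivity of [phi] keeps the difference vector of each competitor nonzero, so the kernel bound
    q^-L applies to it. Since [A] is independent of [X], the left-hand side is the error probability
    given [X = x]. *)
Lemma conditional_error_union_bound (x : 'cV[K]_N) : 0 < f x ->
  (P (A @^-1` err x) <=
   ((\sum_(x' | (x' != x) && (f x <= f x')%R) 1) * q ^- L)%:E)%E.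
Proof.
move=> fx0.
pose E (x' : 'cV[K]_N) :=
  A @^-1` [set M | M *m (map_mx phi x' - map_mx phi x) = 0].
apply: (@le_trans _ _ (\sum_(x' | (x' != x) && (f x <= f x')%R) P (E x'))%E).
  apply: measure_fin_union_bound; [exact: A_rv|by move=> x'; exact: A_rv|].
  by move=> t /(decoding_error_competitor phi_inj dec_MAP fx0).
rewrite mulr_suml -sumEFin; apply: lee_sum => x' /andP[x'x _].
rewrite mul1r; apply: (iid_matrix_kernel_prob A_rv A_unif A_indep).
rewrite subr_eq0; apply: contra x'x => /eqP.
by move=> /(inj_map_mx phi_inj) ->.
Qed.

Lemma conditional_error_tilted_bound (rho : R) (x : 'cV[K]_N) :
  0 < rho <= 1 -> 0 < f x ->
  f x * fine (P (A @^-1` err x)) <=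
  f x `^ (1 / (1 + rho)) *
    ((\sum_x' f x' `^ (1 / (1 + rho))) * q ^- L) `^ rho.
Proof.
move=> /andP[rho0 rho1] fx0; set s := 1 / (1 + rho).
have s0 : 0 <= s by rewrite divr_ge0//; lra.
set S := \sum_x' _; set p := fine _.
have qL0 : 0 <= q ^- L by rewrite invr_ge0 exprn_ge0.
have mE : measurable (A @^-1` err x) := A_rv (err x).
have pE : p%:E = P (A @^-1` err x) by rewrite fineK// fin_num_measure.
have p01 : 0 <= p <= 1.
  by rewrite -!lee_fin pE measure_ge0 probability_le1.
(* Each competitor contributes 1 <= (f x' / f x)^s; the other terms of [S] are nonnegative and may
   be added. *)
have pu : p <= f x `^ (- s) * (S * q ^- L).
  rewrite -lee_fin pE; apply: (le_trans (conditional_error_union_bound fx0)).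
  rewrite lee_fin mulrA ler_wpM2r// mulr_sumr.
  rewrite big_mkcond/=; apply: ler_sum => x' _.
  case: ifP => [/andP[_ fxx']|_]; last by rewrite mulr_ge0// powR_ge0.
  rewrite powRN mulrC -ler_pdivrMr ?invr_gt0 ?powR_gt0// invrK mul1r.
  by apply: ge0_ler_powR => //; rewrite nnegrE.
have rho01 : 0 <= rho <= 1 by rewrite (ltW rho0).
have := min1_le_powR p01 pu rho01; rewrite powRM ?powR_ge0//; last first.
  by rewrite mulr_ge0// sumr_ge0// => x' _; exact: powR_ge0.
rewrite -powRrM => /(ler_wpM2l (f_ge0 x)) /le_trans; apply.
rewrite mulrA ler_wpM2r ?powR_ge0// -{1}[f x]powRr1// -powRD.
  (* This equation dictates the choice s = 1 / (1 + rho): the factor left in front is again f(x)^s,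
     so that summing over [x] yields one more factor [S]. *)
  by have -> : 1 + - s * rho = s by rewrite /s; field; lra.
by apply/implyP => _; rewrite gt_eqF.
Qed.

Lemma error_probability_tilted_bound (rho : R) : 0 < rho <= 1 ->
  (error_probability P phi f dec X A <=
   ((\sum_x f x `^ (1 / (1 + rho))) `^ (1 + rho) * (q ^- L) `^ rho)%:E)%E.
Proof.
move=> rho01; have /andP[rho0 _] := rho01.
set S := \sum_x _.
have S0 : 0 <= S by apply: sumr_ge0 => x _; exact: powR_ge0.
have errE x : P (X @^-1` [set x] `&` A @^-1` err x) =
    (f x * fine (P (A @^-1` err x)))%:E.
  have mE : measurable (A @^-1` err x) := A_rv (err x).
  by rewrite EFinM fineK ?fin_num_measure// setIC AX_indep X_pmf muleC.
apply: (@le_trans _ _ (\sum_x P (X @^-1` [set x] `&` A @^-1` err x))%E).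
  apply: measure_fin_union_bound => [|x|t et]; last by exists (X t).
    (* The error event involves [X] and [A] jointly, while measurability is known for each
       separately; a finite union of intersections bridges the gap. *)
    rewrite (_ : [set t | _] = \bigcup_(x in [set: 'cV[K]_N])
        (X @^-1` [set x] `&` A @^-1` err x)); last first.
      apply/seteqP; split => t /=; first by exists (X t).
      by move=> [x _ [/= <-]].
    apply: fin_bigcup_measurable => // x _.
    by apply: measurableI; [exact: X_rv|exact: A_rv].
  by apply: measurableI; [exact: X_rv|exact: A_rv].
under eq_bigr => x _ do rewrite errE.
rewrite sumEFin lee_fin.
apply: (@le_trans _ _ (\sum_x f x `^ (1 / (1 + rho)) * (S * q ^- L) `^ rho)).
  apply: ler_sum => x _; have := f_ge0 x; rewrite le_eqVlt => /predU1P[<-|fx0].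
    by rewrite mul0r mulr_ge0// powR_ge0.
  exact: conditional_error_tilted_bound.
rewrite -mulr_suml -/S powRM// ?invr_ge0 ?exprn_ge0// mulrA.
rewrite ler_wpM2r ?powR_ge0// powRD ?powRr1//.
by rewrite paddr_eq0 ?ler01 ?(ltW rho0)// oner_eq0.
Qed.

End MAPErrorBound.

Unset Implicit Arguments.

Theorem proposition3 (R : realType)
  (d : measure_display) (T : measurableType d) (P : probability T R)
  (N L : nat) (hN : (0 < N)%N)
  (XX : {fset int}) (F : finFieldType) (hq : (#|{: XX}| <= #|F|)%N)
  (phi : XX -> F) (phi_inj : injective phi)
  (X : T -> 'cV[XX]_N) (f : 'cV[XX]_N -> R)
  (X_rv : discrete_rv X) (X_pmf : has_pmf P X f)
  (A : T -> 'M[F]_(L, N)) (A_rv : discrete_rv A)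
  (A_unif : forall i j, uniformly_distributed P (fun t => A t i j))
  (A_indep : mutually_independent P
     (fun (ij : 'I_L * 'I_N) t => A t ij.1 ij.2))
  (AX_indep : independent P A X)
  (dec : 'M[F]_(L, N) -> 'cV[F]_L -> 'cV[F]_N)
  (dec_MAP : is_MAP_decoder phi f dec)
  (delta : R) (hdelta : 0 < delta < 1)
  (rho : R) (hrho : 0 < rho <= 1) :
  let q : R := #|F|%:R in
  let f_rho := tilted rho f in
  L%:R / N%:R >= - (log2 delta / (rho * N%:R * log2 q))
                 + entropy f_rho / (N%:R * log2 q)
                 - KL f_rho f / (rho * N%:R * log2 q) ->
  (error_probability P phi f dec X A <= delta%:E)%E.
Proof.
move=> q f_rho hL.
have /andP[rho0 rho1] := hrho; have /andP[delta0 _] := hdelta.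
apply: (le_trans (error_probability_tilted_bound phi_inj X_rv X_pmf A_rv A_unif
  A_indep AX_indep dec_MAP hrho)); rewrite -/q lee_fin.
have f0 := pmf_ge0 X_pmf.
have S0 : 0 < \sum_x f x `^ (1 / (1 + rho)).
  rewrite lt_neqAle eq_sym sumr_ge0 => [|x _]; last exact: powR_ge0.
  rewrite andbT; apply/negP => /eqP S0.
  have := pmf_sum_ge1 X_rv X_pmf; rewrite big1 ?ler10// => x _.
  have /eqP := psumr_eq0P (fun x _ => powR_ge0 (f x) _) S0 (erefl : xpredT x).
  by rewrite powR_eq0 => /andP[/eqP].
have q1 : 1 < q by rewrite ltr1n card_finNzRing_gt1.
have q0 : 0 < q by lra.
have qL0 : 0 < q ^- L by rewrite invr_gt0 exprn_gt0.
(* In logarithmic form the goal becomes (1 + rho) log2 S - rho L log2 q <= log2 delta. *)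
rewrite -ler_log2 ?posrE ?mulr_gt0 ?powR_gt0//.
rewrite log2M ?powR_gt0// !log2_powR -powR_invn ?(ltW q0)// log2_powR.
have N0 : 0 < N%:R :> R by rewrite ltr0n.
have Q0 : 0 < log2 q := log2_gt0 q1.
(* Multiplying the condition on [L] by this constant clears all denominators and leaves rho L log2 q
   >= rho (H - D / rho) - log2 delta, where the entropy identity evaluates H - D / rho. *)
have c0 : 0 <= rho * N%:R * log2 q.
  exact: ltW (mulr_gt0 (mulr_gt0 rho0 N0) Q0).
have := entropy_tilted_KL f0 S0 rho0; rewrite -/f_rho.
move: hL => /(ler_wpM2r c0).
set S := \sum_x _; set H := entropy _; set D := KL _ _.
have -> : L%:R / N%:R * (rho * N%:R * log2 q) = rho * L%:R * log2 q.
  by field; lra.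
have -> : (- (log2 delta / (rho * N%:R * log2 q)) + H / (N%:R * log2 q)
    - D / (rho * N%:R * log2 q)) * (rho * N%:R * log2 q)
    = rho * (H - D / rho) - log2 delta.
  by field; lra.
move=> + HD; rewrite HD.
have -> : rho * ((1 + rho) / rho * log2 S) = (1 + rho) * log2 S.
  by field; lra.
lra.
Qed.
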